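(* Let $R$ be a commutative ring with identity. (a) Every comorphic $R$-module is Hopfian. (b) Every morphic $R$-module is co-Hopfian.
   Context: A proper submodule $N$ of an $R$-module $M$ is completely irreducible if whenever $N=\bigcap_{i\in I}N_i$ for a family $\{N_i\}_{i\in I}$ of submodules of $M$, then $N=N_i$ for some $i\in I$. For a submodule $N$ of $M$, $(N:_RM)=\{r\in R: rM\subseteq N\}$; for $a\in R$, $(0:_Ma)=\{m\in M: am=0\}$; $\mathrm{Ann}_R(X)$ denotes the annihilator in $R$ of $X$. An $R$-module $M$ is comorphic if for each completely irreducible submodule $L$ of $M$ there exists $a\in R$ such that $L=aM$ and $(L:_RM)=Ra+\mathrm{Ann}_R(M)$. An $R$-module $M$ is morphic if for each $m\in M$ there exists $a\in R$ such that $Rm=(0:_Ma)$ and $\mathrm{Ann}_R(Rm)=Ra+\mathrm{Ann}_R(M)$. An $R$-module is Hopfian (resp. co-Hopfian) if every surjective (resp. injective) $R$-endomorphism of it is an isomorphism. *)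

(* Defs.v *)
From mathcomp Require Import all_boot all_algebra.
From mathcomp Require Import boolp classical_sets functions.

Set Implicit Arguments.
Unset Strict Implicit.
Unset Printing Implicit Defensive.

Import GRing.Theory.
Local Open Scope classical_set_scope.
Local Open Scope ring_scope.

Section Modules.
Variables (R : comPzRingType) (M : lmodType R).
Implicit Types (N L : set M) (X : set M) (a : R) (m : M).

Definition submodule N : Prop := GRing.submod_closed [in N].

Definition completely_irreducible N : Prop :=
  [/\ submodule N,
      N <> setT
    & forall (I : Type) (F : I -> set M),
        (forall i, submodule (F i)) -> N = \bigcap_i F i -> exists i, N = F i].

(* (N :_R M) *)
Definition colon N : set R := [set r | forall m, N (r *: m)].

(* (0 :_M a) *)
Definition torsion a : set M := [set m | a *: m = 0].

Definition Ann X : set R := [set r | forall x, X x -> r *: x = 0].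

(* aM *)
Definition multiples a : set M := range (fun m => a *: m).

(* Rm *)
Definition cyclic m : set M := range (fun r : R => r *: m).

(* Ra + Ann_R(M) *)
Definition principal_plus_Ann a : set R :=
  [set r * a + s | r in [set: R] & s in Ann setT].

Definition comorphic : Prop :=
  forall L, completely_irreducible L ->
    exists a, L = multiples a /\ colon L = principal_plus_Ann a.

Definition morphic : Prop :=
  forall m, exists a,
    cyclic m = torsion a /\ Ann (cyclic m) = principal_plus_Ann a.

Definition isomorphism (f : {linear M -> M}) : Prop :=
  exists g : {linear M -> M}, cancel f g /\ cancel g f.

Definition Hopfian : Prop :=
  forall f : {linear M -> M}, set_surj [set: M] [set: M] f -> isomorphism f.

Definition coHopfian : Prop :=
  forall f : {linear M -> M}, injective f -> isomorphism f.

End Modules.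

Arguments comorphic {R} M.
Arguments morphic {R} M.
Arguments Hopfian {R} M.
Arguments coHopfian {R} M.

(* Main.v *)
Require Import Defs.
From HB Require Import structures.
From mathcomp Require Import all_boot all_algebra.
From mathcomp Require Import boolp classical_sets functions.

(**
(a) Let f be surjective and suppose f x = 0 with x nonzero.  By Zorn there is a
completely irreducible L that does not contain x.  Its preimage is again
completely irreducible, so f^-1(L) = bM for some b; then L contains f(bM) = bM
and hence bM = f^-1(L), which contains x: a contradiction.

(b) Let f be injective and write R(f m) = (0 :_M b).  Then f (b m) = b (f m) = 0,
so b m = 0, that is, m lies in R(f m), which is contained in the image of f.
*)

Set Implicit Arguments.
Unset Strict Implicit.
Unset Printing Implicit Defensive.

Import GRing.Theory.
Local Open Scope classical_set_scope.
Local Open Scope ring_scope.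

Section Modules.
Variables (R : comPzRingType) (M : lmodType R).
Implicit Types (N L : set M) (f : {linear M -> M}).

(** Trades the boolean predicate [[in N]] for propositional membership. *)
Lemma submoduleP N :
  submodule N <-> N 0 /\ forall a u v, N u -> N v -> N (a *: u + v).
Proof.
split=> -[N0 NL]; split.
- by rewrite inE in N0.
- by move=> a u v Nu Nv; have := NL a u v; rewrite !inE; apply.
- by rewrite inE.
- by move=> a u v; rewrite !inE; apply: NL.
Qed.

Lemma submodule0 N : submodule N -> N 0.
Proof. by case/submoduleP. Qed.

Lemma submoduleD N u v : submodule N -> N u -> N v -> N (u + v).
Proof. by case/submoduleP=> _ NL Nu Nv; rewrite -[u]scale1r; apply: NL. Qed.

Lemma submodule_preimage f N : submodule N -> submodule (f @^-1` N).
Proof.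
case/submoduleP=> N0 NL; apply/submoduleP; split; first by rewrite /= linear0.
by move=> a u v /= Nu Nv; rewrite linearP; apply: NL.
Qed.

Lemma submodule_image f N : submodule N -> submodule (f @` N).
Proof.
case/submoduleP=> N0 NL; apply/submoduleP; split.
  by exists 0; rewrite ?linear0.
move=> a _ _ [u Nu <-] [v Nv <-].
by exists (a *: u + v); [apply: NL | rewrite linearP].
Qed.

Lemma preimage_imageK f N : submodule N -> (forall x, f x = 0 -> N x) ->
  f @^-1` (f @` N) = N.
Proof.
move=> sN kN; apply/seteqP; split=> [x [y Ny fyx] | x Nx]; last by exists x.
rewrite -(subrK y x); apply: submoduleD => //; apply: kN.
by rewrite linearB /= fyx subrr.
Qed.

(** A submodule that contains the kernel of [f] is recovered from its image, so a decomposition of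
    the preimage of [L] pushes forward to one of [L], and the resulting equality pulls back. *)
Lemma completely_irreducible_preimage f L : set_surj [set: M] [set: M] f ->
  completely_irreducible L -> completely_irreducible (f @^-1` L).
Proof.
move=> fs [sL L1 Lirr]; split; first exact: submodule_preimage.
- move=> fL1; apply: L1; apply/seteqP; split=> // y _.
  have [x _ <-] := fs y I.
  by have : (f @^-1` L) x by rewrite fL1.
- move=> J F sF FL.
  have kF j x : f x = 0 -> F j x.
    move=> fx0; suff : (f @^-1` L) x by rewrite FL; apply.
    by rewrite /= fx0; apply: submodule0.
  have [|j Lj] := Lirr J (fun j => f @` F j) (fun j => submodule_image f (sF j)).
    apply/seteqP; split=> y.
      have [x _ <-] := fs y I; move=> Lfx j _; exists x => //.
      by have : (f @^-1` L) x by []; rewrite FL; apply.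
    (* Images need not commute with intersections; they do here because every [F j] contains the
       kernel. *)
    have [x _ <-] := fs y I; move=> Fy.
    have : (f @^-1` L) x; last by [].
    rewrite FL => j _; rewrite -(preimage_imageK (sF j) (kF j)).
    exact: Fy.
  by exists j; rewrite Lj preimage_imageK //; apply: kF.
Qed.

(** Take [L] maximal among the submodules that avoid [x]: every strictly larger submodule contains
    [x], so an intersection of such submodules cannot be [L]. *)
Lemma exists_completely_irreducible (x : M) : x <> 0 ->
  exists L, completely_irreducible L /\ ~ L x.
Proof.
move=> x0.
(* Membership of 0 is left out so that the empty chain has an upper bound;
   maximality restores it. *)
pose P N := (forall a u v, N u -> N v -> N (a *: u + v)) /\ ~ N x.
have [|L [[LL Lx] Lmax]] := @Zorn_bigcup M P.
  move=> C CP Ctot; split; last by case=> N CN; case: (CP N CN).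
  move=> a u v [N1 CN1 N1u] [N2 CN2 N2v].
  case: (Ctot _ _ CN1 CN2) => sub.
    by exists N2 => //; case: (CP N2 CN2) => + _; apply; [apply: sub|].
  by exists N1 => //; case: (CP N1 CN1) => + _; apply; [|apply: sub].
have L0 : L 0.
  case: (pselect (L !=set0)) => [[u Lu]|/set0P/negP/negPn/eqP L_0].
    by rewrite -(addNr u) -scaleN1r; apply: LL.
  (* Were [L] empty, [[set 0]] would be strictly larger and still satisfy [P], as [x] is nonzero. *)
  exfalso; apply: (Lmax [set 0]).
    by split=> [u|/(_ 0 erefl)]; rewrite L_0.
  by split=> // a u v -> ->; rewrite scaler0 addr0.
exists L; split=> //; split; first exact/submoduleP.
- by move=> L1; apply: Lx; rewrite L1.
- move=> J F sF LF; apply: contrapT => LnF; apply: Lx; rewrite LF => j _.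
  apply: contrapT => Fx.
  have LFj : L `<=` F j by rewrite LF => y; apply.
  apply: (Lmax (F j)); last by split=> //; case/submoduleP: (sF j).
  by split=> // FjL; apply: LnF; exists j; apply/seteqP; split.
Qed.

Lemma linear_bijective_isomorphism f : injective f ->
  set_surj [set: M] [set: M] f -> isomorphism f.
Proof.
move=> fi fs.
have /choice[g gK] : forall y, exists x, f x = y.
  by move=> y; have [x _ <-] := fs y I; exists x.
have fK : cancel f g by move=> x; apply: fi; rewrite gK.
pose gL := GRing.isLinear.Build R M M *:%R g (can2_linear fK gK).
pose G : {linear M -> M} := HB.pack g gL.
by exists G.
Qed.

Lemma comorphic_Hopfian : comorphic M -> Hopfian M.
Proof.
move=> cM f fs; apply: linear_bijective_isomorphism => //.
apply: raddf_inj => x fx0; apply: contrapT => x0.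
have [L [ciL Lx]] := exists_completely_irreducible x0.
have [b [fLb _]] := cM _ (completely_irreducible_preimage fs ciL).
have [y _ byx] : multiples b x.
  by rewrite -fLb /= fx0; apply: submodule0; case: ciL.
(* With [y = f z] one gets [x = f (b *: z)], where [b *: z] lies in [multiples b], the preimage of
   [L]. *)
apply: Lx; rewrite -byx; have [z _ <-] := fs y I.
by rewrite -linearZ; have : (f @^-1` L) (b *: z) by rewrite fLb; exists z.
Qed.

Lemma morphic_coHopfian : morphic M -> coHopfian M.
Proof.
move=> mM f fi; apply: linear_bijective_isomorphism => // m _.
have [b [fmb _]] := mM (f m).
have bfm : torsion b (f m) by rewrite -fmb; exists 1; rewrite ?scale1r.
have [r _ rfm] : cyclic (f m) m.
  by rewrite fmb; apply: fi; rewrite linearZ linear0.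
(* The preimage comes from [m = r *: f m = f (r *: m)]. *)
by exists (r *: m); rewrite // linearZ.
Qed.

End Modules.

Theorem proposition2p21 (R : comPzRingType) :
  (forall M : lmodType R, comorphic M -> Hopfian M) /\
  (forall M : lmodType R, morphic M -> coHopfian M).
Proof. by split=> M; [apply: comorphic_Hopfian | apply: morphic_coHopfian]. Qed.
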